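(* Let $A_n(x)$ denote the classical Eulerian polynomials. For every $n\geqslant 1$, the derivative of $A_n(x)$ equals the $n\times n$ determinant $$\frac{\mathrm{d}}{\mathrm{d}x} A_n(x)= \begin{vmatrix} 1 & -1 & 0 & 0 & \cdots & 0\\ A_1(x) & 1+x & -1 & 0 & \cdots & 0\\ A_2(x) & 2\binom{2}{1}A_1(x) & 1+x & -1 & \cdots & 0\\ A_3(x) & 2\binom{3}{1}A_2(x) & 2\binom{3}{2}A_1(x) & 1+x & \cdots & 0\\ \vdots & \vdots & \vdots & \vdots & \ddots & -1\\ A_{n-1}(x) & 2\binom{n-1}{1}A_{n-2}(x) & 2\binom{n-1}{2}A_{n-3}(x) & 2\binom{n-1}{3}A_{n-4}(x) & \cdots & 1+x \end{vmatrix},$$ that is, the determinant of the matrix whose $(i,1)$ entry is $A_{i-1}(x)$ for $1\leqslant i\leqslant n$ (with $A_0(x)=1$), whose $(i,i)$ entry is $1+x$ for $2\leqslant i\leqslant n$, whose $(i,j)$ entry is $2\binom{i-1}{j-1}A_{i-j}(x)$ for $2\leqslant j<i\leqslant n$, whose $(i,i+1)$ entries are $-1$, and whose $(i,j)$ entries with $j>i+1$ are $0$.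
   Context: The classical Eulerian polynomials $A_n(x)$ are defined by $A_0(x)=1$ and $A_n(x)=nxA_{n-1}(x)+x(1-x)\frac{\mathrm{d}}{\mathrm{d}x}A_{n-1}(x)$ for $n\geqslant 1$. Equivalently, for $n\geqslant 1$, $A_n(x)=\sum_{\pi\in\mathfrak{S}_n}x^{\mathrm{des}(\pi)}$, where $\mathfrak{S}_n$ is the set of permutations $\pi=\pi_1\pi_2\cdots\pi_n$ of $\{1,\ldots,n\}$ and $\mathrm{des}(\pi)$ is the number of indices $i\in\{1,\ldots,n\}$ with $\pi_i>\pi_{i+1}$, with the convention $\pi_{n+1}=0$. *)

(* Defs.v *)
From mathcomp Require Import all_boot all_order all_algebra.

Set Implicit Arguments.
Unset Strict Implicit.
Unset Printing Implicit Defensive.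

Import GRing.Theory.
Local Open Scope ring_scope.

Fixpoint eulerian (n : nat) : {poly int} :=
  match n with
  | 0%N => 1
  | m.+1 => m.+1%:R * 'X * eulerian m + 'X * (1 - 'X) * (eulerian m)^`()
  end.

(* Rows and columns are numbered from 0, so the entry in position (i, j) here
   is the entry (i + 1, j + 1) of the usual 1-based numbering. *)
Definition eulerian_deriv_mx (n : nat) : 'M[{poly int}]_n :=
  \matrix_(i < n, j < n)
    if j == 0%N :> nat then eulerian i
    else if j == i :> nat then 1 + 'X
    else if (j < i)%N then 2%:R * 'C(i, j)%:R * eulerian (i - j)%N
    else if j == i.+1 :> nat then -1
    else 0.

(* Main.v *)
(** Multiplying the lower Hessenberg matrix on the right by the unipotent matrix
    whose first column is [1, A_1', ..., A_(n-1)'] leaves only its last entry in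
    the first column, provided [A_n'] obeys the recurrence obtained by expanding
    the determinant along its last row.  This recurrence is the derivative of
    [A_(m+1) = (x - 1) A_m + S_m], where [S_m = \sum_j 'C(m, j) A_j A_(m-j)]; the
    latter holds because both sides start at [x] and are propagated by the same
    differential operator [f |-> (m + 2) x f + x (1 - x) f']. *)
Require Import Defs.
From mathcomp Require Import all_boot all_order all_algebra.
From mathcomp Require Import ring.
Import GRing.Theory.
Local Open Scope ring_scope.

Lemma det_lower_hessenberg (R : comNzRingType) (a : nat -> nat -> R)
    (d : nat -> R) (n : nat) :
    d 0%N = 1 -> (forall i, d i.+1 = \sum_(j < i.+1) a i j * d j) ->
  \det (\matrix_(i < n, j < n)
     if (j <= i)%N then a i j else if j == i.+1 :> nat then -1 else 0) = d n.
Proof.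
move=> d0 dS; case: n => [|n]; first by rewrite det_mx00.
set H := \matrix_(i, j) _.
pose V : 'M[R]_n.+1 := \matrix_(i, j) if j == 0 then d i else (i == j)%:R.
have detV : \det V = 1.
  rewrite det_trig; last first.
    apply/is_trig_mxP => i j ltij; rewrite mxE -!val_eqE /=.
    by rewrite gtn_eqF ?(leq_ltn_trans _ ltij) // ltn_eqF.
  by rewrite big1 // => i _; rewrite mxE; case: eqP => [->|]; rewrite ?eqxx ?d0.
have HV0 i : (H *m V) i 0 = (i == ord_max)%:R * d n.+1.
  pose F j := (if (j <= i)%N then a i j
               else if j == i.+1 :> nat then -1 else 0) * d j.
  have sumF : \sum_(j < i.+1) F j = d i.+1.
    rewrite dS; apply: eq_bigr => j _.
    by rewrite /F -ltnS ltn_ord.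
  transitivity (\sum_(j < n.+1) F j).
    by rewrite mxE; apply: eq_bigr => j _; rewrite !mxE eqxx.
  have [i_max|neq_i] := eqVneq i ord_max.
    by rewrite mul1r; move: sumF; rewrite i_max.
  have lt_in : (i < n)%N by rewrite ltn_neqAle neq_i -ltnS ltn_ord.
  (* Above the last row, the entries up to the diagonal contribute [d i.+1], the superdiagonal [-1]
     cancels it, and all later entries vanish. *)
  rewrite -(big_mkord xpredT F) (@big_cat_nat _ _ _ i.+2) //=.
  rewrite big_nat_recr //= big_mkord sumF /F ltnn eqxx mulN1r subrr add0r mul0r.
  rewrite big_nat_cond big1 // => j /andP[/andP[lt_ij _] _].
  by rewrite leqNgt (ltnW lt_ij) /= gtn_eqF // mul0r.
have HVS i j : (H *m V) i (lift 0 j) = H i (lift 0 j).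
  rewrite mxE (bigD1 (lift 0 j)) //= big1 => [|k ne_k].
    by rewrite [V _ _]mxE eqxx mulr1 addr0.
  by rewrite [V _ _]mxE (negbTE ne_k) mulr0.
rewrite -[LHS]mulr1 -detV -det_mulmx (expand_det_col _ 0).
rewrite (bigD1 ord_max) //= big1 ?addr0 => [|i ne_i]; last first.
  by rewrite HV0 (negbTE ne_i) !mul0r.
have lift_max (i : 'I_n) : lift ord_max i = i :> nat.
  by rewrite /= /bump leqNgt ltn_ord.
(* The minor left is lower triangular with diagonal [-1], so its determinant (-1)^n cancels the
   cofactor sign (-1)^n. *)
rewrite HV0 eqxx mul1r /cofactor det_trig; last first.
  apply/is_trig_mxP => i j lt_ij.
  rewrite 2!mxE HVS mxE lift_max lift0.
  by rewrite ltnNge ltnW //= gtn_eqF.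
rewrite (eq_bigr (fun=> -1)) => [|i _]; last first.
  rewrite 2!mxE HVS mxE lift_max lift0.
  by rewrite ltnn eqxx.
by rewrite prodr_const card_ord addn0 -exprD addnn -mul2n exprM sqrrN !expr1n mulr1.
Qed.

Definition eulerian_conv (m : nat) : {poly int} :=
  \sum_(j < m.+1) 'C(m, j)%:R * (eulerian j * eulerian (m - j)).

Lemma eulerianS (m : nat) :
  eulerian m.+1 =
    m.+1%:R * 'X * eulerian m + 'X * (1 - 'X) * (eulerian m)^`().
Proof. by []. Qed.

(** Pascal's rule under the sum; it lets S_(m+1) be compared with S_m term by term. *)
Lemma sum_binS (R : comNzRingType) (F : nat -> R) (m : nat) :
  \sum_(j < m.+2) 'C(m.+1, j)%:R * F j =
  \sum_(j < m.+1) 'C(m, j)%:R * (F j + F j.+1).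
Proof.
rewrite big_ord_recl bin0; under eq_bigr do rewrite /= binS natrD mulrDl.
rewrite big_split /= addrA.
have -> : 1 * F 0%N + \sum_(i < m.+1) 'C(m, i.+1)%:R * F i.+1 =
          \sum_(i < m.+1) 'C(m, i)%:R * F i.
  by rewrite big_ord_recr /= bin_small // mul0r addr0 [RHS]big_ord_recl bin0.
by rewrite -big_split; apply: eq_bigr => j _; rewrite mulrDr.
Qed.

(** The symmetry j -> m - j identifies the two halves of the product rule; this is the source of the
    factor 2 in the matrix entries. *)
Lemma deriv_eulerian_conv (m : nat) :
  (eulerian_conv m)^`() =
  2%:R * \sum_(j < m.+1) 'C(m, j)%:R * (eulerian (m - j) * (eulerian j)^`()).
Proof.
rewrite /eulerian_conv raddf_sum /=.
under eq_bigr do rewrite mulr_natl derivMn derivM mulrnDl.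
rewrite big_split /= mulr_natl mulr2n; congr (_ + _).
  by apply: eq_bigr => j _; rewrite mulr_natl [X in X *+ _]mulrC.
rewrite (reindex_inj rev_ord_inj); apply: eq_bigr => j _ /=.
by rewrite subSS bin_sub -1?ltnS // subKn -1?ltnS // mulr_natl.
Qed.

Lemma eulerian_convS (m : nat) :
  eulerian_conv m.+1 =
    m.+2%:R * 'X * eulerian_conv m + 'X * (1 - 'X) * (eulerian_conv m)^`().
Proof.
rewrite /eulerian_conv.
rewrite (@sum_binS _ (fun j => eulerian j * eulerian (m.+1 - j))).
rewrite raddf_sum /= !mulr_sumr -big_split; apply: eq_bigr => j _ /=.
have le_jm : (j <= m)%N by rewrite -ltnS.
rewrite subSS subSn // !eulerianS (mulr_natl (eulerian j * _)) derivMn derivM.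
(* The recurrences for A_(j+1) and A_(m-j+1) bring coefficients j+1 and m-j+1, whose sum does not
   depend on j. *)
have -> : m.+2%:R = j.+1%:R + (m - j).+1%:R :> {poly int}.
  by rewrite -natrD addSn addnS subnKC.
by ring.
Qed.

Lemma eulerianS_conv (m : nat) :
  eulerian m.+1 = ('X - 1) * eulerian m + eulerian_conv m.
Proof.
elim: m => [|m IHm].
  rewrite /eulerian_conv big_ord1 /= derivC bin0; ring.
rewrite [in RHS]eulerianS eulerian_convS eulerianS IHm.
(* Differentiating the factor x - 1 yields the extra term -x(x-1) A_m, which lowers m+2 to the
   coefficient m+1 of the recurrence for A_(m+1). *)
rewrite derivD derivM derivB derivX derivC.
by rewrite -[m.+2%:R]natr1; ring.
Qed.

Lemma deriv_eulerianS (m : nat) :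
  (eulerian m.+1)^`() =
    eulerian m + ('X - 1) * (eulerian m)^`() +
    2%:R * \sum_(j < m.+1) 'C(m, j)%:R * (eulerian (m - j) * (eulerian j)^`()).
Proof.
by rewrite eulerianS_conv derivD derivM derivB derivX derivC subr0 mul1r
           deriv_eulerian_conv.
Qed.

#[local] Arguments eulerian : simpl never.

Theorem theorem2p2 (n : nat) (hn : (1 <= n)%N) :
  (eulerian n)^`() = \det (eulerian_deriv_mx n).
Proof.
pose a i j : {poly int} :=
  if j == 0%N then eulerian i else if j == i then 1 + 'X
  else 2%:R * 'C(i, j)%:R * eulerian (i - j)%N.
(* The value at 0 is 1 instead of A_0' = 0: it multiplies the first column and so supplies the
   summand A_i of [deriv_eulerianS]. *)
pose d n := if n is 0%N then 1 else (eulerian n)^`().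
have deriv_eulerian0 : (eulerian 0)^`() = 0 by exact: derivC.
have -> : (eulerian n)^`() = d n by case: n hn.
rewrite -(@det_lower_hessenberg _ a) // => [|i]; last first.
  rewrite /d deriv_eulerianS big_ord_recl /= deriv_eulerian0 !mulr0 add0r.
  rewrite [in RHS]big_ord_recl /a /= mulr1.
  case: i => [|i]; first by rewrite !big_ord0 deriv_eulerian0 !mulr0 addr0.
  (* The last summand 2 A_0 A_(i+1)' merges with (x-1) A_(i+1)' to give the diagonal entry 1 + x. *)
  rewrite !big_ord_recr /= /bump !add1n eqxx binn subnn mul1r [eulerian 0]/1 mul1r.
  rewrite -addrA mulrDr mulr_sumr.
  congr (_ + _); rewrite addrCA; congr (_ + _); last by ring.
  apply: eq_bigr => j _.
  by rewrite /= /bump !add1n eqSS ltn_eqF // !mulrA.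
congr (\det _); apply/matrixP => i j; rewrite !mxE /a.
case: (ltngtP j i) => [//|lt_ij|->] //.
by rewrite [j == 0%N :> nat]gtn_eqF // (leq_ltn_trans _ lt_ij).
Qed.
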